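(* Let $d,N^+,N^-\ge1$ be integers, let $M=N^+N^-$, and let $\hat z_i=(\hat x_i^+,\hat x_i^-)\in\mathbb{R}^d\times\mathbb{R}^d$, $i=1,\dots,M$, be the $M$ pairs formed by one positively labelled and one negatively labelled training data point. Let $C>0$, $\epsilon\ge0$ and $Z=\mathbb{R}^d\times\mathbb{R}^d$. Then the variable-support distributionally robust AUC problem (DR-AUC-V) $$\min_{w\in\mathbb{R}^d}\ \Big[\tfrac12\|w\|^2+C\sup_{p\in\mathcal P}\ \int_Z h(w;z)\,p(dz)\Big],$$ with $h$ and $\mathcal P$ as defined in the context, is equivalent to the following convex optimization problem: $$\begin{aligned} \min_{w\in\mathbb{R}^d,\ \lambda\ge0,\ t\in\mathbb{R}^M}\quad & \tfrac12\|w\|^2+C\Big(\frac1M\sum_{i=1}^M t_i+\lambda\epsilon\Big)\\ \text{s.t.}\quad & t_i\ \ge\ 1-w^T(\hat x_i^+-\hat x_i^-)\quad \forall i\in\{1,\dots,M\},\\ & t_i\ \ge\ 0\quad \forall i\in\{1,\dots,M\},\\ & \|w\|_\infty\le\lambda . \end{aligned}$$ Here ''equivalent'' means that the two problems have the same optimal value, and that $w$ is optimal for DR-AUC-V if and only if there exist $\lambda$ and $t$ such that $(w,\lambda,t)$ is optimal for the second problem.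
   Context: $\|\cdot\|$ is the Euclidean norm, $\|\cdot\|_1$ the $\ell_1$ norm and $\|\cdot\|_\infty$ the infinity norm on $\mathbb{R}^d$. The pairwise hinge loss of $w\in\mathbb{R}^d$ at $z=(x^+,x^-)\in Z$ is $h(w;z)=\max\{0,\,1-(w^Tx^+-w^Tx^-)\}$. The distance between $z_1=(x_1^+,x_1^-)$ and $z_2=(x_2^+,x_2^-)$ is $d_z(z_1,z_2)=\|x_1^+-x_2^+\|_1+\|x_1^--x_2^-\|_1$. The reference distribution assigns probability $1/M$ to each atom $\hat z_i$. The ambiguity set (the Kantorovich ball of radius $\epsilon$ around the reference distribution, with neither the number nor the locations of the atoms prescribed) is the set $\mathcal P$ of all Borel probability measures $p$ on $Z$ for which there exist nonnegative finite Borel measures $K(\hat z_i,\cdot)$ on $Z$, $i=1,\dots,M$, such that $$\sum_{i=1}^M K(\hat z_i,\cdot)=p,\qquad \int_Z K(\hat z_i,dz)=\frac1M\ \ \forall i,\qquad \sum_{i=1}^M\int_Z d_z(\hat z_i,z)\,K(\hat z_i,dz)\le\epsilon .$$ *)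

(* Defs.v *)
From HB Require Import structures.
From mathcomp Require Import all_boot all_order all_algebra.
From mathcomp Require Import all_classical all_reals all_analysis.

Set Implicit Arguments.
Unset Strict Implicit.
Unset Printing Implicit Defensive.

Import Order.TTheory GRing.Theory Num.Theory.
Import numFieldNormedType.Exports.

Local Open Scope classical_set_scope.
Local Open Scope ring_scope.

(* Vectors are column vectors. The norm [`|w|] that the library puts on
   ['cV[R]_d] is the infinity norm, and the topology is the usual one. *)
Section norms.
Context {R : realType} {n : nat}.
Implicit Types w x : 'cV[R]_n.

Definition dot w x : R := (w^T *m x) 0 0.
Definition norm1 x : R := \sum_i `|x i 0|.
Definition norm2 x : R := Num.sqrt (\sum_i x i 0 ^+ 2).

End norms.

(* R^d x R^d with its Borel sigma-algebra, i.e. the one generated by the open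
   sets of the product topology. *)
Definition Z (R : realType) (d : nat) :=
  g_sigma_algebraType (@open ('cV[R]_d * 'cV[R]_d)%type).

Section dr_auc.
Context {R : realType} {d M : nat}.
Implicit Types (w : 'cV[R]_d) (z : Z R d) (zhat : 'I_M -> Z R d) (C eps : R).

Definition hinge w z : R := Num.max 0 (1 - (dot w z.1 - dot w z.2)).

Definition dist_z (z1 z2 : Z R d) : R :=
  norm1 (z1.1 - z2.1) + norm1 (z1.2 - z2.2).

Definition ambiguity_set zhat eps : set (probability (Z R d) R) :=
  [set p | exists K : 'I_M -> {finite_measure set (Z R d) -> \bar R},
    [/\ forall A, measurable A -> (\sum_(i < M) K i A = p A)%E,
        forall i, K i setT = (M%:R^-1)%:E
      & (\sum_(i < M) \int[K i]_z (dist_z (zhat i) z)%:E <= eps%:E)%E]].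

(* The supremum is extended-real valued, hence so is the objective. *)
Definition dr_objective zhat C eps w : \bar R :=
  ((2^-1 * norm2 w ^+ 2)%:E
   + C%:E * ereal_sup [set \int[p]_z (hinge w z)%:E
                      | p in ambiguity_set zhat eps])%E.

(* The variables are (w, lambda, t). [R^o] is [R] as a vector space over itself,
   so that the triples form a vector space. *)
Definition cvx_objective C eps (v : 'cV[R]_d * R^o * 'cV[R]_M) : R :=
  let: (w, lambda, t) := v in
  2^-1 * norm2 w ^+ 2 + C * (M%:R^-1 * \sum_(i < M) t i 0 + lambda * eps).

Definition cvx_feasible zhat : set ('cV[R]_d * R^o * 'cV[R]_M) :=
  [set v : 'cV[R]_d * R^o * 'cV[R]_M | let: (w, lambda, t) := v in
    [/\ 0 <= lambda,
        forall i, 1 - dot w ((zhat i).1 - (zhat i).2) <= t i 0,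
        forall i, 0 <= t i 0
      & `|w| <= lambda]].

End dr_auc.

Section optimization.
Context {R : realType} {T : Type}.

Definition optimal_value (X : set T) (f : T -> \bar R) : \bar R :=
  ereal_inf (f @` X).

Definition optimal (X : set T) (f : T -> \bar R) (x : T) : Prop :=
  X x /\ forall y, X y -> (f x <= f y)%E.

End optimization.

(* Main.v *)
(* For fixed [w] the inner supremum is computed in closed form:
   it equals the mean of [hinge w] over the atoms plus [`|w| * eps], where
   [`|w|] is the infinity norm.  It is at most that, because [hinge w] is
   [`|w|]-Lipschitz for [dist_z], the infinity norm being dual to the l1 norm.
   Conversely, a vanishing fraction of each atom can be sent far away along a
   direction on which [w] attains its norm; out there the hinge is at least the
   affine function it truncates, so a budget [eps] buys a gain that tends to
   [`|w| * eps].  This closed form is also the partial minimum over [lambda]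
   and [t] of the convex program, attained at [lambda = `|w|] and
   [t i = hinge w (zhat i)]. *)

Require Import Defs.
From HB Require Import structures.
From mathcomp Require Import all_boot all_order all_algebra.
From mathcomp Require Import all_classical all_reals all_analysis.
From mathcomp Require Import measurable_realfun ring lra.

Set Implicit Arguments.
Unset Strict Implicit.
Unset Printing Implicit Defensive.

Import Order.TTheory GRing.Theory Num.Theory.
Import numFieldNormedType.Exports.

Local Open Scope classical_set_scope.
Local Open Scope ring_scope.

(** * Partial minimization *)

(** The hypotheses say that [F a] is the minimum of [G] over the feasible points above [a], attained
    at [lift a]. Values and minimizers therefore transfer both ways. *)
Lemma optimal_projection (R : realType) (A B : Type) (X : set B)
    (F : A -> \bar R) (G : B -> \bar R) (proj : B -> A) (lift : A -> B) :
    (forall a, X (lift a)) -> (forall a, G (lift a) = F a) ->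
    (forall a, proj (lift a) = a) ->
    (forall b, X b -> (F (proj b) <= G b)%E) ->
  optimal_value setT F = optimal_value X G /\
  forall a, optimal setT F a <-> exists2 b, proj b = a & optimal X G b.
Proof.
move=> Xl Gl pl FG; split.
  apply/eqP; rewrite eq_le; apply/andP; split.
    apply: le_ereal_inf_tmp => _ [b Xb <-].
    by apply: (le_trans _ (FG _ Xb)); apply: ereal_inf_lbound; exists (proj b).
  apply: le_ereal_inf_tmp => _ [a _ <-].
  by rewrite -Gl; apply: ereal_inf_lbound; exists (lift a).
move=> a; split=> [[_ oa]|[b <- [Xb ob]]].
  exists (lift a) => //; split=> // b Xb.
  by rewrite Gl (le_trans (oa (proj b) I)) ?FG.
by split=> // a' _; rewrite (le_trans (FG _ Xb)) // -Gl ob.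
Qed.

(** * Duality between the l1 and infinity norms *)

Section norms.
Context {R : realType} {n : nat}.
Implicit Types w x y : 'cV[R]_n.

Lemma dotE w x : dot w x = \sum_i w i 0 * x i 0.
Proof. by rewrite /dot mxE; apply: eq_bigr => i _; rewrite mxE. Qed.

Lemma dotD w x y : dot w (x + y) = dot w x + dot w y.
Proof. by rewrite /dot mulmxDr mxE. Qed.

Lemma dotN w x : dot w (- x) = - dot w x.
Proof. by rewrite /dot mulmxN mxE. Qed.

Lemma dotZ w a x : dot w (a *: x) = a * dot w x.
Proof. by rewrite /dot -scalemxAr mxE. Qed.

Lemma dotZDl a b w1 w2 x :
  dot (a *: w1 + b *: w2) x = a * dot w1 x + b * dot w2 x.
Proof. by rewrite /dot linearD !linearZ mulmxDl -!scalemxAl !mxE. Qed.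

Lemma norm1Z a x : norm1 (a *: x) = `|a| * norm1 x.
Proof. by rewrite /norm1 mulr_sumr; apply: eq_bigr => i _; rewrite mxE normrM. Qed.

Lemma norm1_0 : norm1 (0 : 'cV[R]_n) = 0.
Proof. by rewrite /norm1 big1 // => i _; rewrite mxE normr0. Qed.

Lemma norm1_ge0 x : 0 <= norm1 x.
Proof. exact: sumr_ge0. Qed.

Lemma le_coord_mx_norm w i : `|w i 0| <= `|w|.
Proof.
by rewrite [leRHS]/Num.norm /= mx_normrE; apply/bigmax_geP; right => /=; exists (i, 0).
Qed.

Lemma ler_dot_norm w x : `|dot w x| <= `|w| * norm1 x.
Proof.
rewrite dotE (le_trans (ler_norm_sum _ _ _)) // mulr_sumr ler_sum // => i _.
by rewrite normrM ler_wpM2r // le_coord_mx_norm.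
Qed.

(** A signed basis vector at a coordinate of largest modulus works; for zero [w] the zero vector
    does, hence [<= 1] and not equality. *)
Lemma exists_norming_vector w : exists2 x, norm1 x <= 1 & dot w x = `|w|.
Proof.
have [w0|] := eqVneq (mx_norm w) 0.
  by exists 0; rewrite ?norm1_0 //; rewrite dotE big1 => [|i _]; rewrite ?mxE ?mulr0.
move=> /mx_norm_neq0[[i j]]; rewrite (ord1 j) /= => wi.
exists (\col_k ((k == i)%:R * Num.sg (w i 0))).
  rewrite /norm1 (bigD1 i) //= big1 => [|k ki]; last first.
    by rewrite mxE (negbTE ki) mul0r normr0.
  by rewrite mxE eqxx mul1r addr0 normr_sg; case: (_ == _).
rewrite dotE (bigD1 i) //= big1 => [|k ki]; last first.
  by rewrite mxE (negbTE ki) mul0r mulr0.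
by rewrite mxE eqxx mul1r addr0 mulrC -normrEsg; exact/esym.
Qed.

Lemma norm2_sqr w : norm2 w ^+ 2 = \sum_i w i 0 ^+ 2.
Proof. by rewrite sqr_sqrtr // sumr_ge0 // => i _; exact: sqr_ge0. Qed.

End norms.

(** * Measurability and Lipschitz bound of the hinge loss *)

Section borel.
Context {R : realType} {d : nat}.
Implicit Types (w : 'cV[R]_d) (z : Z R d).

Lemma continuous_measurable_Z (f : 'cV[R]_d * 'cV[R]_d -> R) :
  continuous f -> measurable_fun [set: Z R d] f.
Proof.
move=> /continuousP cf; apply: (measurability _ (RGenOpens.measurableE R)).
move=> _ [_ [a [b ->] <-]]; rewrite setTI.
by apply: sub_sigma_algebra; exact/cf/interval_open.
Qed.

Lemma continuous_coord_fst i : continuous (fun z : 'cV[R]_d * 'cV[R]_d => z.1 i 0).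
Proof.
move=> z; apply: (@continuous_comp _ _ _ fst (fun x : 'cV[R]_d => x i 0)).
  exact: cvg_fst.
exact: (@coord_continuous R d 1 i 0).
Qed.

Lemma continuous_coord_snd i : continuous (fun z : 'cV[R]_d * 'cV[R]_d => z.2 i 0).
Proof.
move=> z; apply: (@continuous_comp _ _ _ snd (fun x : 'cV[R]_d => x i 0)).
  exact: cvg_snd.
exact: (@coord_continuous R d 1 i 0).
Qed.

Lemma measurable_coord_fst i : measurable_fun [set: Z R d] (fun z => z.1 i 0).
Proof. exact: (continuous_measurable_Z (continuous_coord_fst (i:=i))). Qed.

Lemma measurable_coord_snd i : measurable_fun [set: Z R d] (fun z => z.2 i 0).
Proof. exact: (continuous_measurable_Z (continuous_coord_snd (i:=i))). Qed.

Lemma measurable_hinge w : measurable_fun [set: Z R d] (hinge w).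
Proof.
apply: measurable_maxr => //; apply: measurable_funB => //.
under eq_fun do rewrite !dotE.
by apply: measurable_funB; apply: measurable_sum => i;
  apply: measurable_funM => //; [exact: measurable_coord_fst|exact: measurable_coord_snd].
Qed.

Lemma measurable_dist_z (z0 : Z R d) : measurable_fun [set: Z R d] (dist_z z0).
Proof.
rewrite /dist_z /norm1.
apply: measurable_funD; apply: measurable_sum => i;
  apply: measurableT_comp => //.
  under eq_fun do rewrite !mxE.
  by apply: measurable_funB => //; exact: measurable_coord_fst.
under eq_fun do rewrite !mxE.
by apply: measurable_funB => //; exact: measurable_coord_snd.
Qed.

Lemma hinge_ge0 w z : 0 <= hinge w z.
Proof. by rewrite le_max lexx. Qed.

Lemma dist_z_ge0 (z1 z2 : Z R d) : 0 <= dist_z z1 z2.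
Proof. by rewrite addr_ge0 ?norm1_ge0. Qed.

(** Hölder's inequality on each component bounds the change of the affine part; truncation at 0 is
    harmless because the right-hand side is nonnegative. *)
Lemma hinge_lipschitz w (z0 z : Z R d) :
  hinge w z <= hinge w z0 + `|w| * dist_z z0 z.
Proof.
have := ler_dot_norm w (z0.1 - z.1); have := ler_dot_norm w (z0.2 - z.2).
have := hinge_ge0 w z0; have := dist_z_ge0 z0 z; have := normr_ge0 w.
have : 1 - (dot w z0.1 - dot w z0.2) <= hinge w z0 by rewrite le_max lexx orbT.
rewrite /dist_z !dotD !dotN !ler_norml mulrDr => h1 w0 d0 h0 /andP[h2 _] /andP[_ h3].
rewrite ge_max; apply/andP; split; last lra.
by rewrite -mulrDr addr_ge0 // mulr_ge0.
Qed.

End borel.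

Section measures.

(** * Finite sums of measures *)

Context {R : realType} {disp : measure_display} {T : measurableType disp}.

Lemma two_point_measure (a b : R) (x y : T) : 0 <= a -> 0 <= b ->
  exists K : {finite_measure set T -> \bar R},
    K setT = (a + b)%:E /\
    forall f : T -> R, measurable_fun setT f -> (forall z, 0 <= f z) ->
      (\int[K]_z (f z)%:E = (a * f x + b * f y)%:E)%E.
Proof.
move=> a0 b0.
pose m1 : {finite_measure set T -> \bar R} := mscale (NngNum a0) \d_x.
pose m2 : {finite_measure set T -> \bar R} := mscale (NngNum b0) \d_y.
(* Written so as to be convertible with [measure_add m1 m2], whose lemmas are used below. *)
pose m := msum (fun n => if n is 0%N then m1 : {measure set T -> \bar R} else m2) 2.
have mf : fin_num_fun m.
  move=> A mA; rewrite -[m]/(measure_add m1 m2) measure_addE.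
  by rewrite fin_numD !fin_num_measure.
pose K : {finite_measure set T -> \bar R} :=
  HB.pack m (Measure_isFinite.Build _ _ _ m mf).
exists K; split.
  by rewrite /K /= -[m]/(measure_add m1 m2) measure_addE /m1 /m2 /= /mscale /= !diracT !mule1.
move=> f fm f0; have fme := proj2 (measurable_EFinP _ _) fm.
have fe0 z : setT z -> (0 <= (f z)%:E)%E by rewrite lee_fin.
rewrite /K /= -[m]/(measure_add m1 m2) ge0_integral_measure_add //.
rewrite /m1 /m2 !ge0_integral_mscale //.
by rewrite !integral_dirac // !diracT !mul1e.
Qed.

Lemma probability_of_sum (M : nat) (K : 'I_M -> {finite_measure set T -> \bar R}) :
    (\sum_(i < M) K i setT = 1)%E ->
  exists p : probability T R, forall A, (\sum_(i < M) K i A = p A)%E.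
Proof.
(* [msum] takes a family indexed by naturals; reindexing by [inord] needs a nonempty ordinal type.
   An empty sum would have mass 0, not 1. *)
case: M K => [K|M K K1].
  by rewrite big_ord0 => /eqP; rewrite eq_sym onee_eq0.
pose m := msum (fun k => K (inord k)) M.+1.
have mE A : (\sum_(i < M.+1) K i A = m A)%E.
  by apply: eq_bigr => i _; rewrite inord_val.
have m1 : m setT = 1%E by rewrite -mE.
pose p : probability T R := HB.pack m (Measure_isProbability.Build _ _ _ m m1).
by exists p.
Qed.

Lemma ge0_integral_sum_measure (M : nat)
    (K : 'I_M -> {finite_measure set T -> \bar R}) (p : probability T R)
    (f : T -> \bar R) :
    (forall A, measurable A -> (\sum_(i < M) K i A = p A)%E) ->
    measurable_fun setT f -> (forall z, (0 <= f z)%E) ->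
  (\int[p]_z f z = \sum_(i < M) \int[K i]_z f z)%E.
Proof.
case: M K => [K /(_ setT measurableT)|M K Kp fm f0].
  by rewrite big_ord0 probability_setT => /eqP; rewrite eq_sym onee_eq0.
rewrite (@eq_measure_integral _ _ _ _ (msum (fun k => K (inord k)) M.+1)); last first.
  move=> A mA _; apply: (etrans (esym (Kp A mA))).
  by apply: eq_bigr => i _; rewrite inord_val.
rewrite ge0_integral_measure_sum //.
by apply: eq_bigr => i _; rewrite inord_val.
Qed.

End measures.

(** * Closed form of the worst-case expectation *)

Section worst_case.
Context {R : realType} {d M : nat}.
Implicit Types (w : 'cV[R]_d) (zhat : 'I_M -> Z R d) (C eps : R).

Definition mean_hinge zhat w : R := M%:R^-1 * \sum_(i < M) hinge w (zhat i).

(** Split the integral along the transport plan [K] and apply the Lipschitz bound from each atom: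
    the masses [1 / M] produce the mean hinge, and the transport cost is at most [eps]. *)
Lemma worst_case_le zhat eps w (p : probability (Z R d) R) :
  ambiguity_set zhat eps p ->
  (\int[p]_z (hinge w z)%:E <= (mean_hinge zhat w + `|w| * eps)%:E)%E.
Proof.
move=> [K [Kp K1 Kc]].
have mh : measurable_fun [set: Z R d] (fun z => (hinge w z)%:E).
  exact: (proj2 (measurable_EFinP _ _) (measurable_hinge w)).
have md i : measurable_fun [set: Z R d] (fun z => (dist_z (zhat i) z)%:E).
  exact: (proj2 (measurable_EFinP _ _) (measurable_dist_z (zhat i))).
have h0 z : (0 <= (hinge w z)%:E)%E by rewrite lee_fin hinge_ge0.
have d0 i z : (0 <= (dist_z (zhat i) z)%:E)%E by rewrite lee_fin dist_z_ge0.
rewrite (ge0_integral_sum_measure Kp mh h0).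
have lip i : (\int[K i]_z (hinge w z)%:E <=
    (M%:R^-1 * hinge w (zhat i))%:E + `|w|%:E * \int[K i]_z (dist_z (zhat i) z)%:E)%E.
  (* Both sides become integrals against [K i], so the pointwise Lipschitz bound can be
     integrated. *)
  have -> : ((M%:R^-1 * hinge w (zhat i))%:E +
      `|w|%:E * \int[K i]_z (dist_z (zhat i) z)%:E =
      \int[K i]_z ((hinge w (zhat i))%:E + `|w|%:E * (dist_z (zhat i) z)%:E))%E.
    rewrite ge0_integralD //.
    - rewrite integral_cst // ge0_integralZl_EFin //.
      rewrite [in LHS]mulrC EFinM; by congr (_ * _ + _)%E; exact/esym/K1.
    - by move=> z _; rewrite -EFinM lee_fin mulr_ge0 ?dist_z_ge0.
    - exact: measurable_funeM.
  apply: ge0_le_integral => //.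
  - by apply: emeasurable_funD => //; apply: measurable_funeM.
  - by move=> z _; rewrite -EFinM -EFinD lee_fin hinge_lipschitz.
apply: (le_trans (lee_sum _ (fun i _ => lip i))).
rewrite big_split /= sumEFin -mulr_sumr EFinD leeD2l //.
rewrite -ge0_sume_distrr => [|i _]; last exact: integral_ge0.
by rewrite EFinM lee_wpmul2l.
Qed.

(* Moving the fraction [a] of every atom by [eps / a] costs [eps]; as [a]
   tends to 0 the gain tends to [`|w| * eps], which is not attained in general. *)
Lemma worst_case_approx zhat eps w e : (0 < M)%N -> 0 <= eps -> 0 < e ->
  exists2 p : probability (Z R d) R, ambiguity_set zhat eps p &
    ((mean_hinge zhat w + `|w| * eps)%:E <= \int[p]_z (hinge w z)%:E + e%:E)%E.
Proof.
move=> M0 eps0 e0.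
have [x x1 wx] := exists_norming_vector w.
have MN0 : M%:R != 0 :> R by rewrite pnatr_eq0 -lt0n.
pose margin i := 1 - (dot w (zhat i).1 - dot w (zhat i).2).
(* Mean gap between the hinge and the affine function it truncates; moving a fraction [a] loses at
   most [a * c] against the ideal gain. *)
pose c := M%:R^-1 * \sum_(i < M) (hinge w (zhat i) - margin i).
have c0 : 0 <= c.
  rewrite mulr_ge0 ?invr_ge0 // sumr_ge0 // => i _.
  by rewrite subr_ge0 le_max lexx orbT.
(* Chosen so that [0 < a <= 1] and [a * c <= e], even when [c] is 0. *)
pose a := e / (e + c).
have ec0 : 0 < e + c by lra.
have a0 : 0 < a by rewrite divr_gt0.
have a1 : a <= 1 by rewrite ler_pdivrMr //; lra.
have ac : a * c <= e.
  by rewrite /a mulrAC ler_pdivrMr //; rewrite ler_wpM2l //; lra.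
pose s := eps / a.
have as_eps : a * s = eps by rewrite /s mulrC divfK // gt_eqF.
have s0 : 0 <= s by rewrite divr_ge0 // ltW.
(* Shifting only the positive point, against the norming vector, raises the affine part by [s * |w|]
   at distance at most [s]. *)
pose y i : Z R d := ((zhat i).1 - s *: x, (zhat i).2).
have Mi0 : 0 <= M%:R^-1 :> R by rewrite invr_ge0.
have atoms i : exists K : {finite_measure set (Z R d) -> \bar R},
    K setT = (M%:R^-1)%:E /\
    forall f : Z R d -> R, measurable_fun setT f -> (forall z, 0 <= f z) ->
      (\int[K]_z (f z)%:E = (M%:R^-1 * ((1 - a) * f (zhat i) + a * f (y i)))%:E)%E.
  have [||K [KT Kf]] := @two_point_measure R _ (Z R d)
    (M%:R^-1 * (1 - a)) (M%:R^-1 * a) (zhat i) (y i).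
  - by rewrite mulr_ge0 // subr_ge0.
  - by rewrite mulr_ge0 // ltW.
  exists K; split=> [|f mf f0]; first by rewrite KT -mulrDr subrK mulr1.
  by rewrite (Kf f mf f0); congr EFin; ring.
have [K {}atoms] := choice atoms.
have sumM (r : R) : \sum_(i < M) M%:R^-1 * r = r.
  by rewrite sumr_const card_ord -(mulr_natl (_ * r)) mulrA divff // mul1r.
have KT : (\sum_(i < M) K i setT = 1)%E.
  rewrite (eq_bigr (fun=> (M%:R^-1 * 1)%:E)) => [|i _].
    by rewrite sumEFin sumM.
  by rewrite (proj1 (atoms i)) mulr1.
have [p Kp] := probability_of_sum KT.
exists p.
  exists K; split=> [A _|i|]; [exact: Kp|exact: (proj1 (atoms i))|].
  (* The budget is shared equally: each atom sends mass [a / M] over a distance at most [s], and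
     [a * s = eps]. *)
  rewrite -(sumM eps) -sumEFin; apply: lee_sum => i _.
  rewrite (proj2 (atoms i)); [|exact: measurable_dist_z|exact: dist_z_ge0].
  rewrite lee_fin ler_wpM2l // /dist_z /y /= !subrr norm1_0 addr0 mulr0 add0r.
  rewrite opprB (addrCA (zhat i).1) subrr !addr0 norm1Z ger0_norm // mulrA as_eps.
  by rewrite -[leRHS]mulr1 ler_wpM2l.
have mh : measurable_fun [set: Z R d] (fun z => (hinge w z)%:E).
  exact: (proj2 (measurable_EFinP _ _) (measurable_hinge w)).
have h0 z : (0 <= (hinge w z)%:E)%E by rewrite lee_fin hinge_ge0.
rewrite (ge0_integral_sum_measure (fun A _ => Kp A) mh h0).
rewrite (eq_bigr _ (fun i _ =>
  proj2 (atoms i) _ (measurable_hinge w) (hinge_ge0 w))) sumEFin -EFinD lee_fin.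
(* Bounding the hinge at [y i] below by its affine part gives this atom by atom; the middle terms
   then sum to [a * c], which is at most [e]. *)
have : \sum_(i < M) (M%:R^-1 * hinge w (zhat i)
         - a * (M%:R^-1 * (hinge w (zhat i) - margin i)) + M%:R^-1 * (`|w| * eps))
     <= \sum_(i < M) M%:R^-1 * ((1 - a) * hinge w (zhat i) + a * hinge w (y i)).
  apply: ler_sum => i _.
  have : margin i + s * `|w| <= hinge w (y i).
    rewrite le_max; apply/orP; right.
    by rewrite /y /= dotD dotN dotZ wx /margin; lra.
  move=> /(ler_wpM2l (ltW a0)); rewrite mulrDr mulrA as_eps => hy.
  have -> : M%:R^-1 * hinge w (zhat i)
      - a * (M%:R^-1 * (hinge w (zhat i) - margin i)) + M%:R^-1 * (`|w| * eps) =
    M%:R^-1 * (hinge w (zhat i) - a * (hinge w (zhat i) - margin i) + `|w| * eps) by ring.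
  by rewrite ler_wpM2l //; lra.
rewrite !big_split /= sumM sumrN -!mulr_sumr -/c -/(mean_hinge zhat w).
lra.
Qed.

(** The two bounds meet at the supremum; as it need not be attained, the lower one is used up to
    every [e > 0]. *)
Lemma dr_objectiveE zhat C eps w : (0 < M)%N -> 0 <= eps ->
  dr_objective zhat C eps w =
  (2^-1 * norm2 w ^+ 2 + C * (mean_hinge zhat w + `|w| * eps))%:E.
Proof.
move=> M0 eps0; rewrite /dr_objective EFinD (EFinM C); congr (_ + _ * _)%E.
apply/eqP; rewrite eq_le; apply/andP; split.
  by apply: ge_ereal_sup => _ [p pP <-]; exact: worst_case_le.
apply/lee_addgt0Pr => e e0.
have [p pP le_p] := worst_case_approx zhat w M0 eps0 e0.
by apply: (le_trans le_p); rewrite leeD2r //; apply: ereal_sup_ubound; exists p.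
Qed.

End worst_case.

(** * Convexity of the reformulated program *)

Section convexity.
Context {R : realType} {d M : nat}.

Lemma norm2_sqr_convex (a : R) (u v : 'cV[R]_d) : 0 <= a -> a <= 1 ->
  norm2 (a *: u + (1 - a) *: v) ^+ 2 <= a * norm2 u ^+ 2 + (1 - a) * norm2 v ^+ 2.
Proof.
move=> a0 a1; rewrite !norm2_sqr !mulr_sumr -big_split ler_sum //= => i _.
(* The convexity gap of the square is itself a nonnegative multiple of a square. *)
rewrite !mxE -subr_ge0 (_ : _ - _ = a * (1 - a) * (u i 0 - v i 0) ^+ 2); last by ring.
by rewrite mulr_ge0 ?sqr_ge0 // mulr_ge0 ?subr_ge0.
Qed.

Lemma cvx_feasible_convex (zhat : 'I_M -> Z R d) : convex_set (cvx_feasible zhat).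
Proof.
move=> [[w1 l1] t1] [[w2 l2] t2] p; rewrite !inE.
move=> [l10 m1 t10 wl1] [l20 m2 t20 wl2].
have a0 : 0 <= p%:num by [].
have b0 : 0 <= 1 - p%:num by rewrite subr_ge0.
(* Unfolds the abstract convex combination of triples into its components. *)
change (cvx_feasible zhat (p%:num *: w1 + (1 - p%:num) *: w2,
  p%:num * l1 + (1 - p%:num) * l2, p%:num *: t1 + (1 - p%:num) *: t2)).
move: (p%:num) a0 b0 => a a0 b0; split.
- by rewrite addr_ge0 // mulr_ge0.
- move=> i; rewrite dotZDl !mxE.
  by have := ler_wpM2l a0 (m1 i); have := ler_wpM2l b0 (m2 i); lra.
- by move=> i; rewrite !mxE addr_ge0 // mulr_ge0.
- rewrite (le_trans (ler_normD _ _)) // !normrZ !ger0_norm //.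
  by rewrite lerD // ler_wpM2l.
Qed.

(** Everything except the squared norm is linear in the triple. *)
Lemma cvx_objective_convex (X : set ('cV[R]_d * R^o * 'cV[R]_M)) (C eps : R) :
  convex_function X (cvx_objective C eps).
Proof.
move=> p [[w1 l1] t1] [[w2 l2] t2] _ _.
have a0 : 0 <= p%:num by [].
have a1 : p%:num <= 1 by [].
change (cvx_objective C eps (p%:num *: w1 + (1 - p%:num) *: w2,
    p%:num * l1 + (1 - p%:num) * l2, p%:num *: t1 + (1 - p%:num) *: t2) <=
  p%:num * cvx_objective C eps (w1, l1, t1) +
  (1 - p%:num) * cvx_objective C eps (w2, l2, t2)).
move: (p%:num) a0 a1 => a a0 a1.
have := norm2_sqr_convex w1 w2 a0 a1.
rewrite /cvx_objective; under eq_bigr do rewrite !mxE.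
rewrite big_split /= -!mulr_sumr; lra.
Qed.

End convexity.

(** * Equivalence of the two problems *)

Theorem theorem2 (R : realType) (d Np Nm : nat)
    (hd : (1 <= d)%N) (hNp : (1 <= Np)%N) (hNm : (1 <= Nm)%N)
    (xp : 'I_Np -> 'cV[R]_d) (xm : 'I_Nm -> 'cV[R]_d)
    (pair_of : 'I_(Np * Nm) -> 'I_Np * 'I_Nm) (hpair : bijective pair_of)
    (C eps : R) (hC : 0 < C) (heps : 0 <= eps) :
  let zhat : 'I_(Np * Nm) -> Z R d :=
    fun i => (xp (pair_of i).1, xm (pair_of i).2) in
  let F := dr_objective zhat C eps in
  let G := @cvx_objective R d (Np * Nm) C eps in
  let X := cvx_feasible zhat in
  [/\ convex_set X /\ convex_function X G,
      optimal_value setT F = optimal_value X (EFin \o G)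
    & forall w : 'cV[R]_d,
        optimal setT F w <->
        exists (lambda : R) (t : 'cV[R]_(Np * Nm)),
          optimal X (EFin \o G) (w, lambda, t)].

Proof.
move=> zhat F G X.
have M0 : (0 < Np * Nm)%N by rewrite muln_gt0 hNp hNm.
pose lift w : 'cV[R]_d * R^o * 'cV[R]_(Np * Nm) :=
  (w, `|w|, \col_i hinge w (zhat i)).
have FE w : F w = (2^-1 * norm2 w ^+ 2 + C * (mean_hinge zhat w + `|w| * eps))%:E.
  exact: dr_objectiveE.
have Xlift w : X (lift w).
  split=> // i; rewrite mxE ?hinge_ge0 //.
  by rewrite dotD dotN le_max lexx orbT.
have Glift w : (EFin \o G) (lift w) = F w.
  rewrite FE /= /mean_hinge.
  by under eq_bigr do rewrite mxE.
(* The two constraints on [t i] together say that it dominates the hinge at the atom; the objective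
   is nondecreasing in [t] and [lambda] since [C > 0] and [eps >= 0]. *)
have FG v : X v -> (F v.1.1 <= (EFin \o G) v)%E.
  case: v => [[w l] t] [l0 tm t0 wl]; rewrite FE /= lee_fin lerD2l.
  rewrite ler_pM2l // lerD ?ler_wpM2r // ler_wpM2l ?invr_ge0 // ler_sum // => i _.
  by rewrite ge_max t0 -dotN -dotD tm.
have [val_eq opt_iff] := optimal_projection Xlift Glift (fun=> erefl) FG.
split=> // [|w].
  by split; [exact: cvx_feasible_convex|exact: cvx_objective_convex].
rewrite opt_iff; split=> [[[[_ l] t] /= -> ?]|[l [t ?]]]; first by exists l, t.
by exists (w, l, t).
Qed.
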